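(* Let $\mathcal F$ be a fraction of size $n\ge 1$ of the full factorial design $\mathcal D=\mathcal D_1\times\cdots\times\mathcal D_m$, where the factor $\mathcal D_i$ has $s_i$ levels. Then for every $j=1,\ldots,m$, $$n^2 A_j(\mathcal F)=\sum_{f\in\mathcal F}\ \sum_{g\in\mathcal F}\ \sum_{\substack{A=\{a_1,\ldots,a_j\}\subseteq\{1,\ldots,m\}}} S_{a_1}^{(f,g)}\cdots S_{a_j}^{(f,g)},$$ where the inner sum is over all subsets $A$ of $\{1,\ldots,m\}$ with exactly $j$ elements, the sums over $f,g\in\mathcal F$ count design points with multiplicity, and for $i=1,\ldots,m$ $$S_i^{(f,g)}=\begin{cases}-1 & \text{if } f_i\neq g_i,\\ s_i-1 & \text{if } f_i=g_i,\end{cases}$$ with $f_i,g_i$ the $i$-th coordinates of $f$ and $g$.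
   Context: Full factorial design: for $i=1,\ldots,m$ the $s_i$ levels of the $i$-th factor are coded by the $s_i$-th roots of unity, $\mathcal D_i=\{\omega_0^{(s_i)},\ldots,\omega_{s_i-1}^{(s_i)}\}$ with $\omega_k^{(s_i)}=\exp(\sqrt{-1}\,2\pi k/s_i)$, and $\mathcal D=\mathcal D_1\times\cdots\times\mathcal D_m$, with $\#\mathcal D=\prod_{i=1}^m s_i$. A fraction $\mathcal F$ is a (finite) multiset whose elements lie in $\mathcal D$ (replicates are allowed); its size $n=\#\mathcal F$ is the number of its points counted with multiplicity. Let $L=\mathbb Z_{s_1}\times\cdots\times\mathbb Z_{s_m}$ and, for $\alpha\in L$ and $\zeta=(\zeta_1,\ldots,\zeta_m)\in\mathcal D$, let $X^\alpha(\zeta)=\zeta_1^{\alpha_1}\cdots\zeta_m^{\alpha_m}$. The functions $X^\alpha$, $\alpha\in L$, form a basis of the complex functions on $\mathcal D$. The counting function $R:\mathcal D\to\mathbb C$ of $\mathcal F$ is the function whose value $R(\zeta)$ is the number of appearances of $\zeta$ in $\mathcal F$; its coefficients $c_\alpha\in\mathbb C$ are defined by $R=\sum_{\alpha\in L}c_\alpha X^\alpha$. Let $|\alpha|_0$ be the number of non-zero components of $\alpha$. The Generalized Word-Length Pattern (GWLP) of $\mathcal F$ is the vector $(A_0(\mathcal F),\ldots,A_m(\mathcal F))$ with $$A_j(\mathcal F)=\sum_{|\alpha|_0=j}\left(\frac{|c_\alpha|}{c_0}\right)^2,\qquad c_0=c_{(0,\ldots,0)}=\frac{n}{\#\mathcal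 D},$$ where $|c_\alpha|$ is the modulus of $c_\alpha$. *)

(* Defs.v *)
From mathcomp Require Import all_boot all_order all_algebra finmap multiset.
From mathcomp Require Import complex.
From mathcomp Require Import boolp classical_sets reals trigo.

Set Implicit Arguments.
Unset Strict Implicit.
Unset Printing Implicit Defensive.

Import Order.TTheory GRing.Theory Num.Theory.

Local Open Scope ring_scope.
Local Open Scope complex_scope.
Local Open Scope mset_scope.

(* [omega R s k] is exp (sqrt (-1) * 2 pi k / s), written with Euler's formula. *)
Definition omega (R : realType) (s k : nat) : R[i] :=
  cos (2 * pi * k%:R / s%:R) +i* sin (2 * pi * k%:R / s%:R).

Definition levels (R : realType) (s : nat) : seq R[i] :=
  [seq omega R s k | k <- iota 0 s].

Definition point (R : realType) (m : nat) : choiceType := {ffun 'I_m -> R[i]}.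

Definition full_design (R : realType) (m : nat) (s : 'I_m -> nat) :
    {pred point R m} :=
  [pred zeta : point R m | [forall i, zeta i \in levels R (s i)]].

Arguments full_design R {m} s.

(* Z_{s_1} x ... x Z_{s_m}: residues are represented by 0, ..., s_i - 1.  The
   ring 'Z_n is avoided because 'Z_1 has two elements. *)
Definition exponent (m : nat) (s : 'I_m -> nat) : finType :=
  {dffun forall i : 'I_m, 'I_(s i)}.

Definition exponent0 (m : nat) (s : 'I_m -> nat) (hs : forall i, (0 < s i)%N) :
    exponent s :=
  [ffun i => Ordinal (hs i)].

Definition weight (m : nat) (s : 'I_m -> nat) (alpha : exponent s) : nat :=
  #|[set i : 'I_m | (alpha i : nat) != 0%N]|.

Definition monomial (R : realType) (m : nat) (s : 'I_m -> nat)
    (alpha : exponent s) (zeta : point R m) : R[i] :=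
  \prod_(i < m) zeta i ^+ alpha i.

(* A multiset [F] is its own counting function: [F zeta] is the number of
   appearances of [zeta].  The expansion is required on the design only. *)
Definition is_coefs (R : realType) (m : nat) (s : 'I_m -> nat)
    (F : {mset point R m}) (c : {ffun exponent s -> R[i]}) : Prop :=
  forall zeta : point R m, zeta \in full_design R s ->
    (F zeta)%:R = \sum_(alpha : exponent s) c alpha * monomial alpha zeta.

(* The family of coefficients of the counting function; it exists and is unique
   since the monomials form a basis of the functions on the design.  The default
   value 0 of [xget] plays no role. *)
Definition coefs (R : realType) (m : nat) (s : 'I_m -> nat)
    (F : {mset point R m}) : {ffun exponent s -> R[i]} :=
  xget [ffun => 0] [set c : {ffun exponent s -> R[i]} | is_coefs F c]%classic.

(* [A_j(F)]; the modulus [`|z|] of [z : R[i]] is a real element of [R[i]]. *)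
Definition gwlp (R : realType) (m : nat) (s : 'I_m -> nat)
    (hs : forall i, (0 < s i)%N) (F : {mset point R m}) (j : nat) : R[i] :=
  \sum_(alpha : exponent s | weight alpha == j)
    (`|coefs s F alpha| / coefs s F (exponent0 hs)) ^+ 2.

Definition S_fg (R : realType) (m : nat) (s : 'I_m -> nat)
    (f g : point R m) (i : 'I_m) : R[i] :=
  if f i == g i then (s i)%:R - 1 else -1.

(* Main.v *)
Require Import Defs.
From mathcomp Require Import all_boot all_order all_algebra finmap multiset.
From mathcomp Require Import complex.
From mathcomp Require Import reals.
From mathcomp Require Import trigo.
From mathcomp Require Import ring lra.

Set Implicit Arguments.
Unset Strict Implicit.
Unset Printing Implicit Defensive.

Import Order.TTheory GRing.Theory Num.Theory.

Local Open Scope ring_scope.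
Local Open Scope mset_scope.

(** The coefficients of the counting function are its Fourier coefficients,
    [c_alpha = N^-1 * \sum_(f in F) conj (X^alpha f)] with
    [N = s_1 * ... * s_m].  Hence [|c_alpha|^2] is [N^-2] times the double sum
    over [f], [g] in [F] of [conj (X^alpha f) * X^alpha g], and as
    [c_0 = n / N], the factor [n^2 / c_0^2 = N^2] cancels [N^-2].  It remains
    to sum [conj (X^alpha f) * X^alpha g] over the exponents of weight [j].
    Grouping them by their support [A], each sum is a product over the
    coordinates: a coordinate outside [A] contributes 1, and a coordinate [a]
    in [A] contributes the sum of [(conj f_a * g_a)^k] over [0 < k < s_a],
    which is [S_a], because the sum over all [k < s_a] is [s_a] if
    [f_a = g_a] and 0 otherwise ([sum_monomial_support]).

    The coefficients are only characterised by the expansion of the counting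
    function, so the Fourier formula requires that the monomials both span the
    functions on the design and are independent.  Both follow from the same
    orthogonality relation [monomial_orthogonal], in which the sum runs over
    exponents: since each exponent [beta] gives a design point [zeta_beta]
    ([design_point]) and [X^alpha (zeta_beta) = X^beta (zeta_alpha)],
    the orthogonality of monomials as functions on the design is that relation
    read at [zeta_alpha] and [zeta_beta].  This uses that distinct
    exponents give distinct points, that is, that [omega R s 1] is a primitive
    [s]-th root of unity. *)

(** * Products of sums and sums over roots of unity *)

(** Version of [bigA_distr_big_dep] for index types that vary with the
    coordinate.  A dependent choice of indices is the same as a function into
    the tagged union of the index types that respects the tags, which reduces
    the claim to the non-dependent case. *)
Lemma bigA_distr_dffun (R : comPzSemiRingType) (I : finType) (T : I -> finType)
    (Q : forall i, pred (T i)) (F : forall i, T i -> R) :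
  \prod_i \sum_(k | Q i k) F i k =
  \sum_(a : {dffun forall i, T i} | [forall i, Q i (a i)]) \prod_i F i (a i).
Proof.
pose G i : {ffun T i -> R} := [ffun k => if Q i k then F i k else 0].
transitivity (\prod_i \sum_k G i k).
  apply: eq_bigr => i _; rewrite big_mkcond.
  by apply: eq_bigr => k _; rewrite ffunE.
rewrite (eq_bigr _ (fun i _ => big_tag (fun i => G i) i)).
rewrite bigA_distr_big_dep -(@big_fprod R 0 1 *%R +%R I T G).
rewrite (reindex (@fprod_of_dffun I T)); last exact/onW_bij/fprod_of_dffun_bij.
rewrite [RHS]big_mkcond; apply: eq_bigr => a _; case: ifPn => [/forallP Qa|].
  by apply: eq_bigr => i _; rewrite fprodE ffunE Qa.
rewrite negb_forall => /existsP[i nQ].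
by rewrite (bigD1 i) //= fprodE ffunE (negPf nQ) mul0r.
Qed.

Lemma unity_root_neq0 (C : idomainType) (s : nat) (z : C) :
  (0 < s)%N -> z ^+ s = 1 -> z != 0.
Proof. by move=> s0 zs; have := oner_neq0 C; rewrite -zs expf_eq0 s0. Qed.

Lemma conj_unity_root (C : numClosedFieldType) (s : nat) (z : C) :
  (0 < s)%N -> z ^+ s = 1 -> z^* = z^-1.
Proof.
move=> s0 zs; suff z1 : `|z| = 1 by rewrite invC_norm z1 expr1n invr1 mul1r.
by apply/eqP; rewrite -(@pexpr_eq1 _ _ s) ?normr_ge0 // -normrX zs normr1.
Qed.

(** The [s]-th root of unity [conj z * w] is 1 exactly when [z = w]; otherwise
    the geometric sum vanishes by [subrX1]. *)
Lemma sum_unity_root (C : numClosedFieldType) (s : nat) (z w : C) :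
  (0 < s)%N -> z ^+ s = 1 -> w ^+ s = 1 ->
  \sum_(k < s) (z^* * w) ^+ k = (if z == w then s%:R else 0).
Proof.
move=> s0 zs ws; rewrite (conj_unity_root s0 zs).
have z0 := unity_root_neq0 s0 zs.
have [<-|zw] := eqVneq z w.
  rewrite mulVf //; under eq_bigr do rewrite expr1n.
  by rewrite sumr_const card_ord.
apply/eqP; have /eqP := subrX1 (z^-1 * w) s.
rewrite exprMn exprVn zs ws invr1 mulr1 subrr eq_sym mulf_eq0 subr_eq0.
case/orP => // /eqP e; case/eqP: zw.
by rewrite -[RHS](mulVKf z0) e mulr1.
Qed.

(** * The levels as powers of a primitive root of unity *)

Section Levels.
Variable R : realType.
Implicit Types s k : nat.

Lemma omegaD s k l : omega R s (k + l) = omega R s k * omega R s l.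
Proof.
rewrite /omega natrD mulrDr mulrDl cosD sinD.
by apply/eqP; rewrite eq_complex /= !eqxx /= addrC.
Qed.

Lemma omega0 s : omega R s 0 = 1.
Proof. by rewrite /omega mulr0 mul0r cos0 sin0. Qed.

Lemma omegaM s k l : omega R s (k * l) = omega R s k ^+ l.
Proof.
by elim: l => [|l IHl]; rewrite ?muln0 ?omega0 // mulnS omegaD IHl exprS.
Qed.

Lemma omega_unity s k : (0 < s)%N -> omega R s k ^+ s = 1.
Proof.
move=> s0; rewrite -omegaM mulnC omegaM.
suff -> : omega R s s = 1 by rewrite expr1n.
rewrite /omega mulfK ?pnatr_eq0 -?lt0n // mulrC mulr_natr.
by rewrite cos2pi sin2pi.
Qed.

(** With [t = pi * k / s] strictly between 0 and [pi], the real part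
    [cos (2 t) = 1 - 2 sin^2 t] is less than 1. *)
Lemma omega_neq1 s k : (0 < k < s)%N -> omega R s k != 1.
Proof.
case/andP=> k0 ks; have s0 : (0 < s)%N := leq_trans k0 (ltnW ks).
apply/eqP => /(congr1 (@complex.Re R)) /=.
set t : R := pi * (k%:R / s%:R).
have -> : 2 * pi * k%:R / s%:R = t *+ 2 by rewrite /t -mulr_natl; ring.
have kn : (k%:R / s%:R : R) < 1 by rewrite ltr_pdivrMr ?ltr0n // mul1r ltr_nat.
have t0 : 0 < t by rewrite mulr_gt0 ?pi_gt0 // divr_gt0 ?ltr0n.
have tpi : t < pi by rewrite -[ltRHS]mulr1 ltr_pM2l ?pi_gt0.
have st : 0 < sin t by apply: sin_gt0_pi; rewrite t0.
rewrite cos_mulr2n cos2sin2 => e.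
have : sin t ^+ 2 = 0 by lra.
by move/eqP; rewrite sqrf_eq0 gt_eqF.
Qed.

Lemma omega_inj s : {in gtn s &, injective (omega R s)}.
Proof.
suff H k l : (k <= l)%N -> (l < s)%N -> omega R s k = omega R s l -> k = l.
  move=> k l; rewrite !inE => ks ls e.
  by case: (leqP k l) => [/H|/ltnW/H h]; [exact | apply/esym/h].
move=> kl ls; have s0 : (0 < s)%N by exact: leq_ltn_trans ls.
rewrite -{1}(subnKC kl) omegaD => e.
have [lk|lk] := posnP (l - k).
  by apply/eqP; rewrite eqn_leq kl -subn_eq0 lk.
have /eqP[] : omega R s (l - k) != 1.
  by apply: omega_neq1; rewrite lk (leq_ltn_trans (leq_subr _ _)).
have w0 : omega R s k != 0 := unity_root_neq0 s0 (omega_unity k s0).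
by apply: (mulfI w0); rewrite -e mulr1.
Qed.

Lemma levels_unity s z : z \in levels R s -> z ^+ s = 1.
Proof.
case/mapP=> k; rewrite mem_iota /= add0n => ks ->.
by apply: omega_unity; exact: leq_ltn_trans ks.
Qed.

End Levels.

(** * Orthogonality of monomials *)

Section Design.
Variables (R : realType) (m : nat) (s : 'I_m -> nat).
Hypothesis hs : forall i, (0 < s i)%N.
Implicit Types (f g : point R m) (alpha beta : exponent s).

Definition support_set alpha : {set 'I_m} :=
  [set i | (alpha i : nat) != 0%N].

Lemma design_unity f i : f \in full_design R s -> f i ^+ s i = 1.
Proof. by rewrite inE => /forallP/(_ i)/levels_unity. Qed.

Lemma conj_monomialM alpha f g :
  (monomial alpha f)^* * monomial alpha g =
  \prod_i ((f i)^* * g i) ^+ alpha i.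
Proof.
rewrite /monomial rmorph_prod -big_split /=.
by apply: eq_bigr => i _; rewrite rmorphXn exprMn.
Qed.

(** Each coordinate gives a sum over powers of [conj f_i * g_i]; one coordinate
    where [f] and [g] differ makes the product of these sums vanish. *)
Lemma monomial_orthogonal f g :
    f \in full_design R s -> g \in full_design R s ->
  \sum_alpha (monomial (s := s) alpha f)^* * monomial alpha g =
    (if f == g then (\prod_i s i)%:R else 0).
Proof.
move=> Df Dg; rewrite (eq_bigr _ (fun a _ => conj_monomialM a f g)).
transitivity (\prod_i \sum_(k < s i) ((f i)^* * g i) ^+ k).
  rewrite (bigA_distr_dffun (fun i => predT)
            (fun i (k : 'I_(s i)) => ((f i)^* * g i) ^+ k)).
  by apply: eq_bigl => a; apply/esym/forallP.
under eq_bigr do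
  rewrite (sum_unity_root (hs _) (design_unity _ Df) (design_unity _ Dg)).
have [->|fg] := eqVneq f g.
  by rewrite natr_prod; apply: eq_bigr => i _; rewrite eqxx.
have [i fgi] : exists i, f i != g i.
  apply/existsP; rewrite -negb_forall; apply: contra fg => /forallP h.
  by apply/eqP/ffunP => i; exact/eqP.
by rewrite (bigD1 i) //= (negPf fgi) mul0r.
Qed.

(** The source of [S_fg]: it is the sum over the nonzero exponents of a single
    factor, that is, the full sum over powers minus the term [k = 0]. *)
Lemma sum_monomial_support (A : {set 'I_m}) f g :
    f \in full_design R s -> g \in full_design R s ->
  \sum_(alpha | support_set alpha == A)
     (monomial alpha f)^* * monomial alpha g = \prod_(a in A) S_fg s f g a.
Proof.
move=> Df Dg; rewrite (eq_bigr _ (fun a _ => conj_monomialM a f g)).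
pose Q i : pred 'I_(s i) := fun k => ((k : nat) != 0%N) == (i \in A).
transitivity (\prod_i \sum_(k | Q i k) ((f i)^* * g i) ^+ k).
  rewrite (bigA_distr_dffun Q (fun i (k : 'I_(s i)) => ((f i)^* * g i) ^+ k)).
  apply: eq_bigl => a; apply/eqP/forallP => [sA i|h].
    by rewrite /Q -sA inE eqxx.
  by apply/setP => i; rewrite inE; have /eqP := h i.
rewrite [RHS]big_mkcond; apply: eq_bigr => i _.
have := sum_unity_root (hs i) (design_unity i Df) (design_unity i Dg).
rewrite (bigD1 (Ordinal (hs i))) //= expr0 /Q /S_fg => h; case: (i \in A).
  rewrite (eq_bigl (fun k => k != Ordinal (hs i))); last first.
    by move=> k; rewrite eqb_id.
  rewrite -[LHS](addKr 1) h addrC.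
  by case: ifP; rewrite ?sub0r.
rewrite (big_pred1 (Ordinal (hs i))) ?expr0 // => k.
by rewrite eqbF_neg negbK.
Qed.

(** * Fourier coefficients of the counting function *)

Definition design_point alpha : point R m :=
  [ffun i => omega R (s i) (alpha i)].

Lemma design_point_in alpha : design_point alpha \in full_design R s.
Proof.
rewrite inE; apply/forallP => i; rewrite ffunE.
by apply: map_f; rewrite mem_iota add0n /=.
Qed.

Lemma design_point_inj : injective design_point.
Proof.
move=> a b /ffunP e; apply/ffunP => i; apply/val_inj.
by have := e i; rewrite !ffunE; apply: omega_inj; rewrite -topredE /=.
Qed.

(** The self-duality of a finite abelian group: both sides are the product of
    the [omega R (s i) (alpha i * beta i)]. *)
Lemma monomial_design_pointC alpha beta :
  monomial alpha (design_point beta) = monomial beta (design_point alpha).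
Proof.
by apply: eq_bigr => i _; rewrite !ffunE -!omegaM mulnC.
Qed.

Lemma design_size_neq0 : (\prod_i s i)%:R != 0 :> R[i].
Proof. by rewrite pnatr_eq0 -lt0n prodn_gt0. Qed.

Variable F : {mset point R m}.
Hypothesis hF : forall f, f \in F -> f \in full_design R s.

Definition fourier_coefs : {ffun exponent s -> R[i]} :=
  [ffun alpha => (\prod_i s i)%:R^-1 * \sum_(f <- F) (monomial alpha f)^*].

(** After exchanging the sums, orthogonality leaves one term [N^-1 * N] for each
    occurrence of the given point in [F]. *)
Lemma is_coefs_fourier : is_coefs F fourier_coefs.
Proof.
move=> z Dz; under eq_bigr do rewrite ffunE -mulrA mulr_suml.
rewrite -mulr_sumr exchange_big /=.
transitivity
  ((\prod_i s i)%:R^-1 * \sum_(f <- F | f == z) (\prod_i s i)%:R : R[i]).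
  rewrite big_const_seq count_mem_mset iter_addr_0 mulrnAr mulVf //.
  exact: design_size_neq0.
congr (_ * _); rewrite big_mkcond /=; apply: eq_big_seq => f Ff.
by rewrite monomial_orthogonal //; exact: hF.
Qed.

(** Pairing a vanishing combination of monomials with [conj X^b] over all
    design points isolates the coefficient at [b]. *)
Lemma is_coefs_unique c c' : is_coefs (s := s) F c -> is_coefs F c' -> c = c'.
Proof.
suff H (e : exponent s -> R[i]) :
    (forall z, z \in full_design R s ->
       \sum_alpha e alpha * monomial alpha z = 0) -> e =1 fun=> 0.
  move=> hc hc'; apply/ffunP => a; apply/eqP; rewrite -subr_eq0; apply/eqP.
  apply: (H (fun a => c a - c' a)) => z Dz; under eq_bigr do rewrite mulrBl.
  by rewrite sumrB -hc // -hc' // subrr.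
move=> he b.
have E a : \sum_k (monomial b (design_point k))^* *
      (e a * monomial a (design_point k)) =
    e a * (if b == a then (\prod_i s i)%:R else 0).
  rewrite -(inj_eq design_point_inj).
  rewrite -monomial_orthogonal ?design_point_in // mulr_sumr.
  by apply: eq_bigr => k _; rewrite mulrCA !(monomial_design_pointC _ k).
have : \sum_k (monomial b (design_point k))^* *
          \sum_a e a * monomial a (design_point k) = 0.
  by apply: big1 => k _; rewrite he ?mulr0 // design_point_in.
under eq_bigr do rewrite mulr_sumr.
rewrite exchange_big (eq_bigr _ (fun a _ => E a)) (bigD1 b) //= eqxx.
rewrite [\sum_(a | a != b) _]big1 => [|a ab]; last first.
  by rewrite eq_sym (negPf ab) mulr0.
by move/eqP; rewrite addr0 mulf_eq0 (negPf design_size_neq0) orbF => /eqP.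
Qed.

Lemma coefsE : coefs s F = fourier_coefs.
Proof.
apply: classical_sets.xget_unique => /= [|c hc]; first exact: is_coefs_fourier.
exact: is_coefs_unique hc is_coefs_fourier.
Qed.

Lemma coefs0E : coefs s F (exponent0 hs) = (\prod_i s i)%:R^-1 * (size F)%:R.
Proof.
rewrite coefsE ffunE; congr (_ * _).
rewrite (eq_bigr (fun=> 1)) => [|f _].
  by rewrite big_const_seq count_predT iter_addr_0.
by rewrite /monomial big1 ?rmorph1 // => i _; rewrite ffunE expr0.
Qed.

Lemma coefs_norm_sqr alpha :
  `|coefs s F alpha| ^+ 2 = (\prod_i s i)%:R^-1 ^+ 2 *
     \sum_(f <- F) \sum_(g <- F) (monomial alpha f)^* * monomial alpha g.
Proof.
rewrite normCK coefsE ffunE rmorphM fmorphV rmorph_nat rmorph_sum /=.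
rewrite mulrACA -expr2; congr (_ * _); rewrite mulr_suml; apply: eq_bigr => f _.
by rewrite mulr_sumr; apply: eq_bigr => g _; rewrite conjCK.
Qed.

End Design.

Theorem proposition3p1 (R : realType) (m : nat) (s : 'I_m -> nat)
    (hs : forall i : 'I_m, (0 < s i)%N)
    (F : {mset point R m})
    (hF : forall f : point R m, f \in F -> f \in full_design R s)
    (n : nat) (hn : size F = n) (n_gt0 : (1 <= n)%N)
    (j : nat) (hj : (1 <= j <= m)%N) :
  (n%:R : R[i]) ^+ 2 * gwlp hs F j =
    \sum_(f <- F) \sum_(g <- F)
      \sum_(A : {set 'I_m} | #|A| == j) \prod_(a in A) S_fg s f g a.
Proof.
have N0 := design_size_neq0 R hs.
have n0 : n%:R != 0 :> R[i] by rewrite pnatr_eq0 -lt0n.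
transitivity (\sum_(alpha : exponent s | weight alpha == j)
    \sum_(f <- F) \sum_(g <- F) (monomial alpha f)^* * monomial alpha g).
  rewrite mulr_sumr; apply: eq_bigr => a _.
  rewrite expr_div_n (coefs_norm_sqr hs hF) (coefs0E hs hF) hn.
  set D := \sum_(f <- F) _; move: N0; set N := _%:R => N0.
  by field; rewrite N0 n0.
(* The factor [n^2 / c_0^2] has cancelled the normalisation of the
   coefficients; only the sum over exponents of weight [j] remains. *)
rewrite exchange_big /=; apply: eq_big_seq => f Ff.
rewrite exchange_big /=; apply: eq_big_seq => g Fg.
rewrite (partition_big (@support_set m s) (fun A => #|A| == j)) //=.
apply: eq_bigr => A /eqP cA; rewrite -sum_monomial_support ?hF //.
apply: eq_bigl => a; case: (support_set a =P A) => [sA|_]; last exact: andbF.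
by rewrite andbT /weight -cA -sA eqxx.
Qed.
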